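(* Let $\mathfrak{g}$ be a finite-dimensional complex Lie algebra and $\mathfrak{a}$ an ideal of $\mathfrak{g}$. For $\ell\in\mathfrak{g}^*$ let $\ell_0=\ell_{|\mathfrak{a}}\in\mathfrak{a}^*$, and let $\Omega$ be the Zariski open subset of $\mathfrak{g}^*$ consisting of those $\ell$ for which $\operatorname{codim}_{\mathfrak{a}^*}(\mathfrak{g}.\ell_0)=\operatorname{ind}(\mathfrak{g},\mathfrak{a})$. Then the equality $$\operatorname{ind}(\mathfrak{a})+\operatorname{ind}(\mathfrak{g})=\dim(\mathfrak{g}/\mathfrak{a})+2\operatorname{ind}(\mathfrak{g},\mathfrak{a})$$ holds if and only if for every $\ell\in\Omega$ one has $$\mathfrak{a}^{\ell_0}+\mathfrak{g}^{\ell}=\mathfrak{a}^{\ell}.$$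
   Context: For $\ell\in\mathfrak{g}^*$ put $B_\ell(x,y)=\langle \ell,[x,y]\rangle$ on $\mathfrak{g}\times\mathfrak{g}$. For a subspace $V\subset\mathfrak{g}$, $V^\ell=\{x\in\mathfrak{g}: \langle\ell,[x,v]\rangle=0 \text{ for all } v\in V\}$ is the orthogonal of $V$ in $\mathfrak{g}$ relative to $B_\ell$; in particular $\mathfrak{g}^\ell$ is the kernel of $B_\ell$, and $\mathfrak{a}^\ell$ is the orthogonal of $\mathfrak{a}$ in $\mathfrak{g}$. For $\ell_0\in\mathfrak{a}^*$, $\mathfrak{a}^{\ell_0}=\{x\in\mathfrak{a}: \langle\ell_0,[x,y]\rangle=0\text{ for all }y\in\mathfrak{a}\}$. The index of a Lie algebra $\mathfrak{g}$ is $\operatorname{ind}(\mathfrak{g})=\min_{\ell\in\mathfrak{g}^*}\dim\mathfrak{g}^\ell$ (and likewise for $\mathfrak{a}$, regarded as a Lie algebra). The ideal $\mathfrak{a}$ is a $\mathfrak{g}$-module via the adjoint action, and $\mathfrak{g}$ acts on $\mathfrak{a}^*$ by $\langle x.f,a\rangle=-\langle f,[x,a]\rangle$. For $f\in\mathfrak{a}^*$, $\mathfrak{g}.f=\{x.f:x\in\mathfrak{g}\}\subset\mathfrak{a}^*$, and $\operatorname{ind}(\mathfrak{g},\mathfrak{a})=\min_{f\in\mathfrak{a}^*}\operatorname{codim}_{\mathfrak{a}^*}(\mathfrak{g}.f)$. *)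

(* Defs.v *)
From HB Require Import structures.
From mathcomp Require Import all_boot all_order all_algebra.
From mathcomp Require Import boolp classical_sets reals complex.

Set Implicit Arguments.
Unset Strict Implicit.
Unset Printing Implicit Defensive.

Import GRing.Theory.
Local Open Scope ring_scope.
Local Open Scope classical_set_scope.

(* Minimum of a nat-valued function on a (possibly infinite) nonempty type;
   the point [t0] only witnesses nonemptiness, see [minvalP].               *)
Section MinVal.
Variables (T : Type) (t0 : T) (F : T -> nat).

Lemma minval_ex : exists n, `[< exists t, F t = n >].
Proof. by exists (F t0); apply/asboolP; exists t0. Qed.

Definition minval : nat := ex_minn minval_ex.

Lemma minvalP : (exists t, F t = minval) /\ forall t, (minval <= F t)%N.
Proof.
rewrite /minval; case: ex_minnP => m /asboolP Fm mmin; split=> // t.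
by apply: mmin; apply/asboolP; exists t.
Qed.

End MinVal.

(* Codimension of U in V, i.e. dim (V / U); [\dim U <= \dim V] always holds, so
   the subtraction is not truncated.                                         *)
Definition codimv (K : fieldType) (V : vectType K) (U : {vspace V}) : nat :=
  (\dim {:V} - \dim U)%N.

HB.mixin Record Vector_isLieAlgebra (K : fieldType) (g : Type)
    of Vector K g := {
  lie : g -> g -> g;
  lie_linearl : forall y, linear (lie^~ y);
  lie_linearr : forall x, linear (lie x);
  lie_alt : forall x, lie x x = 0;
  lie_jacobi : forall x y z,
    lie x (lie y z) + lie y (lie z x) + lie z (lie x y) = 0
}.

#[short(type="lieAlgType")]
HB.structure Definition LieAlgebra (K : fieldType) :=
  {g of Vector_isLieAlgebra K g & Vector K g}.

Record lieIdeal (K : fieldType) (g : lieAlgType K) := LieIdeal {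
  ideal_vs :> {vspace g};
  lieIdealP : forall x y : g, y \in ideal_vs -> lie x y \in ideal_vs
}.

Definition dual (K : fieldType) (V : vectType K) : vectType K := 'Hom(V, K^o).

(* An ideal is itself a Lie algebra, carried by the subtype [subvs_of a].
   [vsproj a] is an arbitrary linear projection of g onto a: it is only ever
   applied to elements of a, where it is the identity ([val_ideal_act]).     *)
Section IdealLieAlgebra.
Variables (K : fieldType) (g : lieAlgType K) (a : lieIdeal g).
Implicit Types (u v w : subvs_of a).

Definition ideal_act (x : g) v : subvs_of a := vsproj a (lie x (vsval v)).

Lemma val_ideal_act x v : vsval (ideal_act x v) = lie x (vsval v).
Proof. by rewrite vsprojK // lieIdealP ?subvsP. Qed.

Lemma ideal_act_linearl v : linear (ideal_act^~ v).
Proof. by move=> k x y; rewrite /ideal_act lie_linearl linearP. Qed.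

Lemma ideal_act_linearr x : linear (ideal_act x).
Proof. by move=> k u v; rewrite /ideal_act linearP lie_linearr linearP. Qed.

Definition ideal_lie u v : subvs_of a := ideal_act (vsval u) v.

Lemma ideal_lie_linearl v : linear (ideal_lie^~ v).
Proof. by move=> k u w; rewrite /ideal_lie linearP ideal_act_linearl. Qed.

Lemma ideal_lie_linearr u : linear (ideal_lie u).
Proof. exact: ideal_act_linearr. Qed.

Lemma ideal_lie_alt u : ideal_lie u u = 0.
Proof. by apply: val_inj; rewrite /= val_ideal_act lie_alt. Qed.

Lemma ideal_lie_jacobi u v w :
  ideal_lie u (ideal_lie v w) + ideal_lie v (ideal_lie w u)
    + ideal_lie w (ideal_lie u v) = 0.
Proof. by apply: val_inj; rewrite /= !val_ideal_act lie_jacobi. Qed.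

HB.instance Definition _ := Vector_isLieAlgebra.Build K (subvs_of a)
  ideal_lie_linearl ideal_lie_linearr ideal_lie_alt ideal_lie_jacobi.

Lemma val_ideal_lie u v : vsval (lie u v) = lie (vsval u) (vsval v).
Proof. exact: val_ideal_act. Qed.

End IdealLieAlgebra.

Section Orthogonal.
Variables (K : fieldType) (g : lieAlgType K).

(* x |-> (v |-> <l, [x, v]>) as a linear map from g to V^*, for V in g *)
Definition lie_form (l : dual g) (V : {vspace g}) (x : g) : dual (subvs_of V) :=
  linfun (fun v : subvs_of V => l (lie x (vsval v)) : K^o).

Definition lie_orth (V : {vspace g}) (l : dual g) : {vspace g} :=
  lker (linfun (lie_form l V)).

Lemma lie_formE (l : dual g) (V : {vspace g}) x (v : subvs_of V) :
  lie_form l V x v = l (lie x (vsval v)).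
Proof.
have lin : linear (fun v : subvs_of V => l (lie x (vsval v)) : K^o).
  by move=> k u w; rewrite linearP lie_linearr linearP.
pose L := GRing.isLinear.Build _ _ _ _ _ lin.
pose f : {linear subvs_of V -> K^o} :=
  HB.pack (fun v : subvs_of V => l (lie x (vsval v)) : K^o) L.
exact: (lfunE f).
Qed.

Lemma lie_orthP (V : {vspace g}) (l : dual g) x :
  reflect (forall v, v \in V -> l (lie x v) = 0) (x \in lie_orth V l).
Proof.
have lin : linear (lie_form l V).
  move=> k y z; apply/lfunP => v.
  by rewrite add_lfunE scale_lfunE !lie_formE lie_linearl linearP.
pose L := GRing.isLinear.Build _ _ _ _ _ lin.
pose f : {linear g -> dual (subvs_of V)} := HB.pack (lie_form l V) L.
rewrite memv_ker (lfunE f) /=; apply: (iffP eqP) => [lx0 v Vv | lx0].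
  have := congr1 (fun h : dual (subvs_of V) => h (Subvs Vv)) lx0.
  by rewrite lie_formE zero_lfunE.
by apply/lfunP => v; rewrite lie_formE zero_lfunE lx0 ?subvsP.
Qed.

Definition lie_stab (l : dual g) : {vspace g} := lie_orth {:g} l.

Definition lie_ind : nat := minval (0 : dual g) (fun l => \dim (lie_stab l)).

End Orthogonal.

Section IdealModule.
Variables (K : fieldType) (g : lieAlgType K) (a : lieIdeal g).

Definition coadj (f : dual (subvs_of a)) (x : g) : dual (subvs_of a) :=
  linfun (fun v : subvs_of a => - f (ideal_act x v) : K^o).

Definition coadj_orbit (f : dual (subvs_of a)) : {vspace dual (subvs_of a)} :=
  limg (linfun (coadj f)).

Lemma coadjE (f : dual (subvs_of a)) x v : coadj f x v = - f (ideal_act x v).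
Proof.
have lin : linear (fun v : subvs_of a => - f (ideal_act x v) : K^o).
  by move=> k u w; rewrite ideal_act_linearr linearP opprD scalerN.
pose L := GRing.isLinear.Build _ _ _ _ _ lin.
pose h : {linear subvs_of a -> K^o} :=
  HB.pack (fun v : subvs_of a => - f (ideal_act x v) : K^o) L.
exact: (lfunE h).
Qed.

Lemma coadj_orbitP (f h : dual (subvs_of a)) :
  reflect (exists x, h = coadj f x) (h \in coadj_orbit f).
Proof.
have lin : linear (coadj f).
  move=> k y z; apply/lfunP => v.
  rewrite add_lfunE scale_lfunE !coadjE ideal_act_linearl linearP.
  by rewrite opprD scalerN.
pose L := GRing.isLinear.Build _ _ _ _ _ lin.
pose F : {linear g -> dual (subvs_of a)} := HB.pack (coadj f) L.
apply: (iffP memv_imgP) => [[x _ ->] | [x ->]]; exists x; rewrite ?memvf //;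
  by rewrite (lfunE F).
Qed.

Definition lie_rel_ind : nat :=
  minval (0 : dual (subvs_of a)) (fun f => codimv (coadj_orbit f)).

Definition dual_res (l : dual g) : dual (subvs_of a) :=
  (l \o linfun (vsval : subvs_of a -> g))%VF.

Lemma dual_resE (l : dual g) v : dual_res l v = l (vsval v).
Proof. by rewrite comp_lfunE lfunE. Qed.

Definition Omega : set (dual g) :=
  [set l | codimv (coadj_orbit (dual_res l)) = lie_rel_ind].

(* a^f for f in a^*, computed in the Lie algebra a and then viewed inside g *)
Definition ideal_stab (f : dual (subvs_of a)) : {vspace g} :=
  (linfun (vsval : subvs_of a -> g) @: lie_stab f)%VS.

Lemma ideal_stabP (f : dual (subvs_of a)) x :
  reflect (exists2 u : subvs_of a, vsval u = x & forall v, f (lie u v) = 0)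
          (x \in ideal_stab f).
Proof.
apply: (iffP memv_imgP) => [[u /lie_orthP fu ->] | [u <- fu]]; exists u.
- by rewrite lfunE.
- by move=> v; rewrite fu ?memvf.
- by apply/lie_orthP => v _; apply: fu.
- by rewrite lfunE.
Qed.

End IdealModule.

Arguments lie_ind {K} g.
Arguments lie_rel_ind {K g} a.
Arguments Omega {K g} a _.

(* Main.v *)
(** Let r = ind (g, a). The left and right kernels of B_l on g x a are a^l and
    a /\ g^l, so on Omega they have dimensions dim (g / a) + r and r. Hence
    a^{l_0} + g^l, which is contained in a^l, has dimension
    dim a^{l_0} + dim g^l - r, and for l in Omega
      dim a^{l_0} + dim g^l <= dim (g / a) + 2 r,
    with equality iff a^{l_0} + g^l = a^l. The left-hand side is at least
    ind a + ind g for every l, with equality for some l in Omega: the ranks of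
    B_l on a x a, g x g and g x a are lower semicontinuous in l along lines, so
    they can be maximized simultaneously. *)

From HB Require Import structures.
Require Import Defs.
From mathcomp Require Import all_boot all_order all_algebra.
From mathcomp Require Import boolp classical_sets reals complex.
From mathcomp Require Import zify.

Set Implicit Arguments.
Unset Strict Implicit.
Unset Printing Implicit Defensive.

Import GRing.Theory Num.Theory.
Local Open Scope ring_scope.
Local Open Scope classical_set_scope.

(** * Ranks of matrices along an affine line *)

Lemma exists_rank_identity (F : fieldType) m n (C : 'M[F]_(m, n)) :
  exists P Q, P *m C *m Q = 1%:M :> 'M_(\rank C).
Proof.
(* [P] and [Q] are one-sided inverses of the two factors in the rank factorization
   [col_base C *m row_base C] of [C]. *)
have [P PC] := row_fullP (col_base_full C).
have [Q CQ] := row_freeP (row_base_free C).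
exists P, Q.
by rewrite -CQ -[row_base C]mul1mx -PC -(mulmxA P (col_base C)) mulmx_base.
Qed.

(** Compress the pencil by the [P] and [Q] that turn its value at [t0] into an identity block. The
    determinant of the compression is a polynomial in [t] with value 1 at [t0]; wherever it does not
    vanish, the rank is at least the size of that block. *)
Lemma rank_line (F : fieldType) m n (A B : 'M[F]_(m, n)) (t0 : F) :
  exists2 p : {poly F}, p != 0 &
    forall t, ~~ root p t -> (\rank (A + t0 *: B)%R <= \rank (A + t *: B)%R)%N.
Proof.
have [P [Q PCQ]] := exists_rank_identity (A + t0 *: B).
pose p := \det (map_mx polyC (P *m A *m Q) + 'X *: map_mx polyC (P *m B *m Q)).
have pE t : p.[t] = \det (P *m (A + t *: B) *m Q).
  rewrite /p -[LHS]/(horner_eval t _) -det_map_mx; congr (\det _).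
  apply/matrixP => i j.
  rewrite mulmxDr mulmxDl -scalemxAr -scalemxAl !mxE.
  by rewrite /= /horner_eval hornerD hornerM hornerX !hornerC.
exists p => [|t].
  apply/eqP => p0; have := pE t0; rewrite p0 horner0 PCQ det1.
  by move/eqP; rewrite eq_sym oner_eq0.
rewrite /root pE -unitfE -unitmxE -row_free_unit => /eqP <-.
by apply: leq_trans (mxrankM_maxl _ _) (mxrankM_maxr _ _).
Qed.

(** * Lower semicontinuity along lines and simultaneous maxima *)

Section Generic.
Variable F : numFieldType.

Lemma exists_nonroot (p : {poly F}) : p != 0 -> exists t, ~~ root p t.
Proof.
move=> p0; apply: contrapT => /forallNP rp.
(* In characteristic zero the first [size p] naturals are distinct, too many to be all roots of
   [p]. *)
have := max_poly_roots (rs := [seq n%:R | n <- iota 0 (size p)]) p0.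
rewrite size_map size_iota ltnn => /(_ _ _)/negP; case=> //.
  by apply/allP => t _; apply/negPn/negP => /rp.
by rewrite map_inj_uniq ?iota_uniq// => m n /eqP; rewrite eqr_nat => /eqP.
Qed.

Variable V : lmodType F.

(* Lower semicontinuity along lines, in the Zariski topology. *)
Definition line_lsc (rho : V -> nat) := forall x y t0,
  exists2 p : {poly F}, p != 0 &
    forall t, ~~ root p t -> (rho (x + t0 *: y)%R <= rho (x + t *: y)%R)%N.

Lemma line_lscD rho1 rho2 : line_lsc rho1 -> line_lsc rho2 ->
  line_lsc (fun x => rho1 x + rho2 x)%N.
Proof.
move=> lsc1 lsc2 x y t0.
have [p p0 pP] := lsc1 x y t0; have [q q0 qP] := lsc2 x y t0.
exists (p * q) => [|t]; first by rewrite mulf_neq0.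
by rewrite rootM negb_or => /andP[/pP ? /qP ?]; rewrite leq_add.
Qed.

(** On the line through [x1] (at parameter 0) and [x2] (at parameter 1), each bound fails only at
    roots of a nonzero polynomial; any non-root of the product serves both. *)
Lemma line_lsc_pair rho1 rho2 x1 x2 : line_lsc rho1 -> line_lsc rho2 ->
  exists x, (rho1 x1 <= rho1 x)%N && (rho2 x2 <= rho2 x)%N.
Proof.
move=> lsc1 lsc2.
have [p p0 pP] := lsc1 x1 (x2 - x1) 0.
have [q q0 qP] := lsc2 x1 (x2 - x1) 1.
have [|t] := @exists_nonroot (p * q); first by rewrite mulf_neq0.
rewrite rootM negb_or => /andP[/pP pt /qP qt].
exists (x1 + t *: (x2 - x1)).
by move: pt qt; rewrite scale0r addr0 scale1r subrKC => -> ->.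
Qed.

(* Maximizing rho1 + rho2 keeps both at their maxima while rho3 is added. *)
Lemma line_lsc_max3 rho1 rho2 rho3 x1 x2 x3 :
    line_lsc rho1 -> line_lsc rho2 -> line_lsc rho3 ->
    (forall x, rho1 x <= rho1 x1)%N -> (forall x, rho2 x <= rho2 x2)%N ->
    (forall x, rho3 x <= rho3 x3)%N ->
  exists x, [/\ rho1 x = rho1 x1, rho2 x = rho2 x2 & rho3 x = rho3 x3].
Proof.
move=> lsc1 lsc2 lsc3 max1 max2 max3.
have [y /andP[y1 y2]] := line_lsc_pair x1 x2 lsc1 lsc2.
have [x /andP[x12 x3x]] := line_lsc_pair y x3 (line_lscD lsc1 lsc2) lsc3.
have := (max1 x, max2 x, max3 x) => -[[]] *.
by exists x; split; lia.
Qed.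

End Generic.

(** * Gram matrices of B_l and dimensions of orthogonals *)

Section LieGram.
Variables (K : fieldType) (g : lieAlgType K).
Implicit Types (l : dual g) (U V : {vspace g}).

Definition lie_gram l U V : 'M[K]_(\dim U, \dim V) :=
  \matrix_(i, j) l (lie (vbasis U)`_i (vbasis V)`_j).

Lemma lieDl (x y z : g) : lie (x + y) z = lie x z + lie y z.
Proof. by have := lie_linearl z 1 x y; rewrite !scale1r. Qed.

Lemma lieDr (x y z : g) : lie z (x + y) = lie z x + lie z y.
Proof. by have := lie_linearr z 1 x y; rewrite !scale1r. Qed.

Lemma lieC (x y : g) : lie x y = - lie y x.
Proof.
apply/eqP; rewrite -addr_eq0; apply/eqP.
by have := lie_alt (x + y); rewrite lieDl !lieDr !lie_alt add0r addr0.
Qed.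

Lemma lie0l (x : g) : lie 0 x = 0.
Proof. by apply: (addrI (lie 0 x)); rewrite -lieDl !addr0. Qed.

Lemma lieZl k (x y : g) : lie (k *: x) y = k *: lie x y.
Proof. by rewrite -[k *: x]addr0 lie_linearl lie0l addr0. Qed.

Lemma lie_suml I (r : seq I) (P : pred I) (f : I -> g) y :
  lie (\sum_(i <- r | P i) f i) y = \sum_(i <- r | P i) lie (f i) y.
Proof. exact: (big_morph (lie^~ y) (fun x z => lieDl x z y) (lie0l y)). Qed.

Lemma lie_gram_tr l U V : (lie_gram l U V)^T = - lie_gram l V U.
Proof. by apply/matrixP => i j; rewrite !mxE lieC linearN. Qed.

Lemma rank_lie_gramC l U V : \rank (lie_gram l U V) = \rank (lie_gram l V U).
Proof. by rewrite -mxrank_tr lie_gram_tr mxrank_opp. Qed.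

Lemma lie_gramD l1 l2 t U V :
  lie_gram (l1 + t *: l2) U V = lie_gram l1 U V + t *: lie_gram l2 U V.
Proof. by apply/matrixP => i j; rewrite !mxE add_lfunE scale_lfunE. Qed.

Lemma mem_lie_orth_vbasis V l (x : g) :
  (forall j : 'I_(\dim V), l (lie x (vbasis V)`_j) = 0) -> x \in lie_orth V l.
Proof.
move=> lx0; apply/lie_orthP => v /coord_vbasis ->.
elim/big_rec: _ => [|j y _ y0].
  by rewrite lieC lie0l oppr0 linear0.
by rewrite lie_linearr linearP /= lx0 y0 scaler0 addr0.
Qed.

(** Rank-nullity: the intersection is the left kernel of B_l on U x V, hence corresponds to the left
    kernel of the Gram matrix. *)
Lemma dim_cap_lie_orth l U V :
  (\dim (U :&: lie_orth V l) + \rank (lie_gram l U V) = \dim U)%N.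
Proof.
set M := lie_gram l U V.
(* [phi] passes from coordinates to vectors of [U]; the image [X] of a basis of [kermx M] will be a
   basis of the intersection. *)
pose phi (w : 'rV[K]_(\dim U)) := \sum_i w 0 i *: (vbasis U)`_i.
have phiU w : phi w \in U.
  by apply: memv_suml => i _; rewrite memvZ ?vbasis_mem ?mem_nth ?size_tuple.
have phiM w (j : 'I_(\dim V)) : l (lie (phi w) (vbasis V)`_j) = (w *m M) 0 j.
  rewrite lie_suml linear_sum !mxE; apply: eq_bigr => i _.
  by rewrite lieZl linearZ mxE.
pose B := row_base (kermx M).
pose X := [tuple phi (row i B) | i < \rank (kermx M)].
have phiB (c : 'I_(\rank (kermx M)) -> K) :
    \sum_i c i *: X`_i = phi ((\row_i c i) *m B).
  under eq_bigr do rewrite -tnth_nth tnth_mktuple scaler_sumr.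
  rewrite exchange_big; apply: eq_bigr => i _.
  rewrite mxE scaler_suml; apply: eq_bigr => j _.
  by rewrite !mxE scalerA.
have Bker : (B <= kermx M)%MS by rewrite eq_row_base.
suff /size_basis : basis_of (U :&: lie_orth V l) X.
  rewrite mxrank_ker => ->.
  by rewrite subnK ?rank_leq_row.
apply/andP; split; first rewrite eqEsubv; first (apply/andP; split).
- apply/span_subvP => _ /mapP[i _ ->]; rewrite memv_cap phiU /=.
  apply: mem_lie_orth_vbasis => j; rewrite phiM.
  have /sub_kermxP -> : (row i B <= kermx M)%MS.
    by rewrite (submx_trans (row_sub _ _)).
  by rewrite mxE.
- apply/subvP => x; rewrite memv_cap => /andP[xU /lie_orthP xV].
  pose w := \row_i coord (vbasis U) i x.
  have xw : x = phi w.
    by rewrite [LHS](coord_vbasis xU); apply: eq_bigr => i _; rewrite mxE.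
  have /submxP[c wc] : (w <= B)%MS.
    rewrite eq_row_base; apply/sub_kermxP/rowP => j; rewrite -phiM -xw mxE.
    by rewrite xV ?vbasis_mem ?mem_nth ?size_tuple.
  have -> : x = \sum_i c 0 i *: X`_i.
    rewrite phiB xw wc; congr (phi (_ *m _)).
    by apply/rowP => i; rewrite mxE.
  apply: memv_suml => i _; by rewrite memvZ ?memv_span ?mem_nth ?size_tuple.
- apply/freeP => c; rewrite phiB => phi0 i.
  have wB0 : (\row_i c i) *m B = 0.
    apply/rowP => j; rewrite [RHS]mxE.
    have /freeP freeU := basis_free (vbasisP U).
    exact: (freeU (((\row_i c i) *m B) 0) phi0).
  have /rowP/(_ i) : \row_i c i = 0 :> 'rV_ _.
    by apply: (row_free_inj (row_base_free (kermx M))); rewrite mul0mx.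
  by rewrite !mxE.
Qed.

End LieGram.

Lemma line_lsc_lie_gram (F : numFieldType) (g : lieAlgType F)
    (U V : {vspace g}) :
  line_lsc (fun l : dual g => \rank (lie_gram l U V)).
Proof.
move=> l1 l2 t0.
have [p p0 pP] := rank_line (lie_gram l1 U V) (lie_gram l2 U V) t0.
by exists p => // t /pP; rewrite !lie_gramD.
Qed.

(** * Dimension formulas for an ideal *)

Section IdealGram.
Variables (K : fieldType) (g : lieAlgType K) (a : lieIdeal g).
Implicit Types (l : dual g) (f : dual (subvs_of a)).

Lemma dim_lie_stab l :
  (\dim (lie_stab l) + \rank (lie_gram l {:g} {:g}) = \dim {:g})%N.
Proof. by rewrite -[RHS](dim_cap_lie_orth l _ {:g}) capfv. Qed.

Lemma dim_lie_orth l :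
  (\dim (lie_orth a l) + \rank (lie_gram l {:g} a) = \dim {:g})%N.
Proof. by rewrite -[RHS](dim_cap_lie_orth l _ a) capfv. Qed.

Lemma dim_cap_lie_stab l :
  (\dim (a :&: lie_stab l) + \rank (lie_gram l {:g} a) = \dim a)%N.
Proof. by rewrite rank_lie_gramC dim_cap_lie_orth. Qed.

Lemma ideal_stab_res l : ideal_stab (dual_res a l) = (a :&: lie_orth a l)%VS.
Proof.
apply/vspaceP => x; rewrite memv_cap.
apply/ideal_stabP/andP => [[u <- fu]|[xa /lie_orthP lx]].
  split; first exact: subvsP.
  apply/lie_orthP => v va.
  by have := fu (Subvs va); rewrite dual_resE val_ideal_lie.
exists (Subvs xa) => // v.
by rewrite dual_resE val_ideal_lie lx ?subvsP.
Qed.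

Lemma dim_ideal_stab f : \dim (ideal_stab f) = \dim (lie_stab f).
Proof.
apply: limg_dim_eq; apply/eqP; rewrite -subv0; apply/subvP => u.
by rewrite memv_cap memv_ker lfunE memv0 -val_eqE => /andP[].
Qed.

Lemma dim_lie_stab_res l :
  (\dim (lie_stab (dual_res a l)) + \rank (lie_gram l a a) = \dim a)%N.
Proof. by rewrite -dim_ideal_stab ideal_stab_res dim_cap_lie_orth. Qed.

Lemma dim_coadj_orbit l :
  \dim (coadj_orbit (dual_res a l)) = \rank (lie_gram l {:g} a).
Proof.
have lin : linear (coadj (dual_res a l)).
  move=> k y z; apply/lfunP => v.
  rewrite add_lfunE scale_lfunE !coadjE ideal_act_linearl linearP.
  by rewrite opprD scalerN.
pose L := GRing.isLinear.Build _ _ _ _ _ lin.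
pose F : {linear g -> dual (subvs_of a)} := HB.pack (coadj (dual_res a l)) L.
(* x.l_0 = 0 means that l vanishes on [x, a], so the orbit map has kernel a^l. *)
have kerE : lker (linfun (coadj (dual_res a l))) = lie_orth a l.
  apply/vspaceP => x; rewrite memv_ker (lfunE F) /=.
  apply/eqP/lie_orthP => [h v va | lx].
    have /eqP := congr1 (fun h : dual _ => h (Subvs va)) h.
    by rewrite coadjE zero_lfunE oppr_eq0 dual_resE val_ideal_act => /eqP.
  apply/lfunP => v.
  by rewrite coadjE zero_lfunE dual_resE val_ideal_act lx ?subvsP ?oppr0.
have := limg_ker_dim (linfun (coadj (dual_res a l))) {:g}.
by rewrite capfv kerE -[RHS](dim_lie_orth l) => /addnI.
Qed.

Lemma codimv_coadj_orbit l :
  codimv (coadj_orbit (dual_res a l)) = \dim (a :&: lie_stab l).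
Proof.
rewrite /codimv dim_coadj_orbit.
have -> : \dim {:dual (subvs_of a)} = \dim a by rewrite dimvf /dim /= muln1.
by rewrite -[X in (X - _)%N](dim_cap_lie_stab l) addnK.
Qed.

(** Composing with a projection onto [a] extends [f], so minimizers over a^* can be lifted to
    g^*. *)
Lemma dual_res_surj f : exists l, dual_res a l = f.
Proof.
exists (f \o linfun (vsproj a))%VF; apply/lfunP => v.
by rewrite dual_resE comp_lfunE lfunE /= vsvalK.
Qed.

Lemma add_stab_sub_orth l :
  (ideal_stab (dual_res a l) + lie_stab l <= lie_orth a l)%VS.
Proof.
rewrite ideal_stab_res subv_add capvSr /=.
apply/subvP => x /lie_orthP lx; apply/lie_orthP => v _.
by rewrite lx ?memvf.
Qed.

(** Since g^l lies in a^l, the intersection of a^{l_0} = a /\ a^l with g^l is just a /\ g^l. *)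
Lemma dim_add_stab l :
  (\dim (ideal_stab (dual_res a l) + lie_stab l) + \dim (a :&: lie_stab l) =
   \dim (lie_stab (dual_res a l)) + \dim (lie_stab l))%N.
Proof.
rewrite -dim_ideal_stab -[RHS]dimv_sum_cap ideal_stab_res -capvA.
congr (_ + \dim (_ :&: _))%N.
apply/esym/capv_idPr; apply: subv_trans (add_stab_sub_orth l).
exact: addvSr.
Qed.

(** a^l and a /\ g^l are the two kernels of one pairing on g x a, so both are complementary to the
    same rank. *)
Lemma dim_lie_orth_codimv l :
  \dim (lie_orth a l) = (codimv a + \dim (a :&: lie_stab l))%N.
Proof.
have := dim_lie_orth l; have := dim_cap_lie_stab l; have := dimvS (subvf a).
by rewrite /codimv; lia.
Qed.

(** This is the dimension comparison for [add_stab_sub_orth] with dim (a /\ g^l) = r added to both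
    sides; equal dimensions force equal subspaces. *)
Lemma Omega_dim_stabP l : Omega a l ->
  (\dim (lie_stab (dual_res a l)) + \dim (lie_stab l)
     <= codimv a + 2 * lie_rel_ind a
     ?= iff ((ideal_stab (dual_res a l) + lie_stab l)%VS == lie_orth a l))%N.
Proof.
rewrite /Omega /= codimv_coadj_orbit => <-.
have [le_dim eq_dim] := dimv_leqif_eq (add_stab_sub_orth l).
rewrite -dim_add_stab mul2n -addnn addnA -dim_lie_orth_codimv.
by split; rewrite ?leq_add2r ?eqn_add2r.
Qed.

End IdealGram.

(** * Generic linear forms and the equivalence *)

Lemma exists_generic (F : numFieldType) (g : lieAlgType F) (a : lieIdeal g) :
  exists l : dual g, [/\ \dim (lie_stab l) = lie_ind g,
    \dim (lie_stab (dual_res a l)) = lie_ind (subvs_of a) & Omega a l].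
Proof.
have [[l1 ind1] min1] := minvalP (0 : dual g) (fun l => \dim (lie_stab l)).
have [[f2 ind2] min2] :=
  minvalP (0 : dual (subvs_of a)) (fun f => \dim (lie_stab f)).
have [[f3 ind3] min3] :=
  minvalP (0 : dual (subvs_of a)) (fun f => codimv (coadj_orbit f)).
have [l2 l2f] := dual_res_surj f2; have [l3 l3f] := dual_res_surj f3.
rewrite -/(lie_ind g) -/(lie_ind (subvs_of a)) -/(lie_rel_ind a)
  in ind1 min1 ind2 min2 ind3 min3.
(* Each minimized dimension is complementary to the rank of a Gram matrix, so the three minimizers
   maximize the ranks on g x g, a x a and g x a. *)
have [| | |l [r1 r2 r3]] := line_lsc_max3 (x1 := l1) (x2 := l2) (x3 := l3)
  (@line_lsc_lie_gram _ g {:g} {:g}) (@line_lsc_lie_gram _ g a a)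
  (@line_lsc_lie_gram _ g {:g} a).
- move=> l; have := min1 l; rewrite -ind1.
  by have := dim_lie_stab l; have := dim_lie_stab l1; lia.
- move=> l; have := min2 (dual_res a l); rewrite -ind2 -l2f.
  by have := dim_lie_stab_res a l; have := dim_lie_stab_res a l2; lia.
- move=> l; have := min3 (dual_res a l); rewrite -ind3 -l3f !codimv_coadj_orbit.
  by have := dim_cap_lie_stab a l; have := dim_cap_lie_stab a l3; lia.
exists l; split.
- rewrite -ind1; apply/eqP.
  by rewrite -(eqn_add2r (\rank (lie_gram l {:g} {:g}))) {2}r1 !dim_lie_stab.
- rewrite -ind2 -l2f; apply/eqP.
  by rewrite -(eqn_add2r (\rank (lie_gram l a a))) {2}r2 !dim_lie_stab_res.
- rewrite /Omega /= -ind3 -l3f !codimv_coadj_orbit; apply/eqP.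
  by rewrite -(eqn_add2r (\rank (lie_gram l {:g} a))) {2}r3 !dim_cap_lie_stab.
Qed.

Theorem mainTheorem1 (R : realType) (g : lieAlgType R[i]) (a : lieIdeal g) :
  (lie_ind (subvs_of a) + lie_ind g = codimv a + 2 * lie_rel_ind a)%N <->
  (forall l : dual g, Omega a l ->
     (ideal_stab (dual_res a l) + lie_stab l)%VS = lie_orth a l).
Proof.
split=> [indE l /Omega_dim_stabP stabP|orthE].
  have [_ ming] := minvalP (0 : dual g) (fun l => \dim (lie_stab l)).
  have [_ mina] := minvalP (0 : dual (subvs_of a)) (fun f => \dim (lie_stab f)).
  (* The equality case only needs the reverse inequality, which [indE] reduces to minimality of the
     two indices. *)
  apply/eqP; rewrite -(geq_leqif stabP) -indE.
  by rewrite leq_add ?mina ?ming.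
(* Conversely, a single [l] in [Omega] realizing both indices suffices. *)
have [l [<- <- Ol]] := exists_generic a.
by apply/eqP; rewrite (Omega_dim_stabP Ol) orthE.
Qed.
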